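(* Let $\omega=\{\omega_n\}_{n\ge 0}$ be a sequence of positive real numbers with $\omega_0=1$ and $\lim_{n\to\infty}\omega_n/\omega_{n+1}=1$. Let $\mathcal{J}_\omega$ be the infinite Jacobi matrix with entries $(\mathcal{J}_\omega)_{j,j+1}=(\mathcal{J}_\omega)_{j+1,j}=\sqrt{\omega_j/\omega_{j+1}}$ for $j\ge1$ and all other entries zero, and let $\{P_n\}_{n\ge0}$ be the associated monic orthogonal polynomials. If $\|\mathcal{J}_\omega\|>2$, then the supremum $$\mathcal{U}_\omega=\sup_{f\in H^2_\omega,\ f\neq0}\frac{|\langle f,zf\rangle_\omega|}{\|zf\|_\omega^2}$$ is attained and the function $$f^*(z)=\sum_{n=0}^\infty P_n(\|\mathcal{J}_\omega\|)z^n$$ is extremal, i.e., $f^*$ is a function in $H^2_\omega$ at which the supremum is attained.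
   Context: $H^2_\omega$ is the Hilbert space of functions $f(z)=\sum_{n\ge0}a_nz^n$ analytic in the open unit disk $\mathbb{D}$ with $\|f\|_\omega^2=\sum_{n\ge0}|a_n|^2\omega_n<\infty$ and inner product $\langle \sum a_nz^n,\sum b_nz^n\rangle_\omega=\sum_{n\ge0}a_n\overline{b_n}\,\omega_n$. Rows and columns of $\mathcal{J}_\omega$ are indexed by $1,2,3,\dots$; $\|\mathcal{J}_\omega\|$ is its operator norm on $\ell^2$. The monic orthogonal polynomials corresponding to $\mathcal{J}_\omega$ (via Favard's theorem) are given by $P_{-1}=0$, $P_0=1$, $P_{n+1}(x)=xP_n(x)-\frac{\omega_n}{\omega_{n+1}}P_{n-1}(x)$ for $n\ge0$. *)

(* Defs.v *)
From Stdlib Require Import Reals ClassicalEpsilon.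
From Coquelicot Require Import Coquelicot.

Local Open Scope R_scope.

(* Componentwise sum; meaningful when the complex series converges. *)
Definition CSeries (a : nat -> C) : C :=
  (Series (fun n => Re (a n)), Series (fun n => Im (a n))).

Definition l2 (x : nat -> C) : Prop := ex_series (fun n => Cmod (x n) ^ 2).

Definition l2norm (x : nat -> C) : R := sqrt (Series (fun n => Cmod (x n) ^ 2)).

(* Rows and columns of [A] are indexed by 1, 2, 3, ...; entry number [S i] of a
   vector is stored at position [i] of the sequence. *)
Definition mat_image (A : nat -> nat -> R) (x y : nat -> C) : Prop :=
  forall i, is_series (fun k => (RtoC (A (S i) (S k)) * x k)%C) (y i).

(* The least bound of [A] on complex l2; it is [p_infty] if [A] does not define
   a bounded operator. *)
Definition opnorm (A : nat -> nat -> R) : Rbar :=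
  Glb_Rbar (fun M => 0 <= M /\
    forall x, l2 x ->
      exists y, mat_image A x y /\ l2 y /\ l2norm y <= M * l2norm x).

Definition jacobi (w : nat -> R) (j k : nat) : R :=
  if Nat.eqb k (S j) then sqrt (w j / w (S j))
  else if Nat.eqb j (S k) then sqrt (w k / w (S k))
  else 0.

Fixpoint orthopoly (w : nat -> R) (n : nat) (x : R) : R :=
  match n with
  | O => 1
  | S m => x * orthopoly w m x
           - w m / w (S m) * match m with O => 0 | S k => orthopoly w k x end
  end.

(* Functions on the unit disk are modelled by functions [C -> C] whose values
   outside the disk play no role. *)
Definition has_expansion (a : nat -> C) (f : C -> C) : Prop :=
  forall z : C, Cmod z < 1 -> is_pseries a z (f z).

(* The coefficients are unique when an expansion exists. *)
Definition coeffs (f : C -> C) : nat -> C :=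
  epsilon (inhabits (fun _ => RtoC 0)) (fun a => has_expansion a f).

Definition H2 (w : nat -> R) (f : C -> C) : Prop :=
  exists a, has_expansion a f /\ ex_series (fun n => Cmod (a n) ^ 2 * w n).

Definition H2_inner (w : nat -> R) (f g : C -> C) : C :=
  CSeries (fun n => (coeffs f n * Cconj (coeffs g n) * RtoC (w n))%C).

Definition H2_norm (w : nat -> R) (f : C -> C) : R :=
  sqrt (Series (fun n => Cmod (coeffs f n) ^ 2 * w n)).

Definition nonzero_on_disk (f : C -> C) : Prop :=
  exists z : C, Cmod z < 1 /\ f z <> RtoC 0.

Definition zmul (f : C -> C) : C -> C := fun z => (z * f z)%C.

Definition quotient (w : nat -> R) (f : C -> C) : R :=
  Cmod (H2_inner w f (zmul f)) / H2_norm w (zmul f) ^ 2.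

Definition U_sup (w : nat -> R) : Rbar :=
  Lub_Rbar (fun r => exists f, H2 w f /\ nonzero_on_disk f /\ r = quotient w f).

Definition extremal (w : nat -> R) (f : C -> C) : Prop :=
  H2 w f /\ nonzero_on_disk f /\ Finite (quotient w f) = U_sup w.

Definition fstar (w : nat -> R) : C -> C := fun z =>
  CSeries (fun n => (RtoC (orthopoly w n (real (opnorm (jacobi w)))) * z ^ n)%C).

(* Main.v *)
Require Import Defs.
From Stdlib Require Import Reals Arith Lra Lia.
From Coquelicot Require Import Coquelicot.

Local Open Scope R_scope.

(** With rho_n = P_(n+1)(L) / P_n(L), the recurrence reads
    L = rho_(n+1) + (w_(n+1) / w_(n+2)) / rho_n, with rho_0 = L.
    If all P_n(M) are positive, Schur's test with the weights
    P_n(M) sqrt(w_(n+1)) shows that M bounds the Jacobi matrix.  Conversely, if M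
    bounds it then all P_n(M) are positive, as a truncation of the same vector
    would otherwise be expanded by more than M.  So P_n(L) > 0 at the norm L, and
    the arithmetic-geometric mean inequality with the weights rho_n bounds the
    quotient by L / 2, with equality for the coefficients P_n(L).

    It remains to see that these coefficients are summable.  Since w_n / w_(n+1)
    tends to 1 and L > 2, one has w_n / w_(n+1) <= L / 2 for large n.  If
    P_(n+1)(L) > P_n(L) for some large n, this persists for some L' < L and for
    all later indices, so L' also bounds the matrix, contradicting the minimality
    of L.  Hence P_n(L) is eventually nonincreasing, and the recurrence turns
    this into P_(n+1)(L) <= L / (2 (L - 1)) P_n(L), a geometric decay. *)

(** * Series and power series with complex coefficients *)

(** Balls in [C] are products of real balls, so convergence is componentwise; this ties complex
    series to [CSeries]. *)
Lemma is_series_C (a : nat -> C) (l : C) :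
  is_series a l <->
  is_series (fun n => Re (a n)) (Re l) /\ is_series (fun n => Im (a n)) (Im l).
Proof.
assert (E : forall n, sum_n a n =
  (sum_n (fun n => Re (a n)) n, sum_n (fun n => Im (a n)) n)).
{ induction n as [|n IH].
  - rewrite !sum_O. destruct (a O); reflexivity.
  - rewrite !sum_Sn, IH. reflexivity. }
unfold is_series. split.
- intros H. split; apply filterlim_locally; intros eps;
  pose proof (proj1 (filterlim_locally _ _) H eps) as H'; revert H';
  apply filter_imp; intros n; rewrite E; intros [H1 H2]; assumption.
- intros [H1 H2]. apply filterlim_locally; intros eps.
  pose proof (proj1 (filterlim_locally _ _) H1 eps) as H1'.
  pose proof (proj1 (filterlim_locally _ _) H2 eps) as H2'.
  generalize (filter_and _ _ H1' H2'). apply filter_imp. intros n [A B].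
  rewrite E. split; assumption.
Qed.

(** The terms of a convergent series tend to 0, which fails beyond the radius of convergence. *)
Lemma CV_radius_ge (a : nat -> R) (x l : R) :
  0 < x -> is_pseries a x l -> Rbar_le x (CV_radius a).
Proof.
intros Hx H. apply Rbar_not_lt_le. intros Hlt.
apply (CV_disk_outside a x).
- rewrite Rabs_pos_eq by lra. exact Hlt.
- apply ex_series_lim_0. exists l.
  apply (is_series_ext (fun k => scal (pow_n x k) (a k))).
  + intros n. rewrite pow_n_pow. exact (Rmult_comm _ _).
  + exact H.
Qed.

(** On the real axis an expansion splits into two real power series; uniqueness of complex
    coefficients thus reduces to the real identity theorem. *)
Lemma has_expansion_real (a : nat -> C) f (x : R) :
  has_expansion a f -> Rabs x < 1 ->
  is_pseries (fun n => Re (a n)) x (Re (f x)) /\ is_pseries (fun n => Im (a n)) x (Im (f x)).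
Proof.
intros H Hx. rewrite <- Cmod_R in Hx. apply H, is_series_C in Hx.
destruct Hx as [H1 H2]. split.
- revert H1. apply is_series_ext. intros n.
  change (Re (RtoC x ^ n * a n)%C = x ^ n * Re (a n)).
  rewrite <- RtoC_pow. apply re_scal_l.
- revert H2. apply is_series_ext. intros n.
  change (Im (RtoC x ^ n * a n)%C = x ^ n * Im (a n)).
  rewrite <- RtoC_pow. apply im_scal_l.
Qed.

Lemma pseries_unique (a b : nat -> R) (f : R -> R) :
  (forall x, Rabs x < 1 -> is_pseries a x (f x)) ->
  (forall x, Rabs x < 1 -> is_pseries b x (f x)) -> forall n, a n = b n.
Proof.
intros Ha Hb n.
assert (R2 : Rabs (/2) < 1) by (rewrite Rabs_pos_eq; lra).
apply PSeries_ext_recip.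
- eapply Rbar_lt_le_trans; [|eapply CV_radius_ge, (Ha _ R2)]; simpl; lra.
- eapply Rbar_lt_le_trans; [|eapply CV_radius_ge, (Hb _ R2)]; simpl; lra.
- exists (mkposreal _ Rlt_0_1). intros y Hy.
  assert (Hy' : Rabs y < 1).
  { change (Rabs (y - 0) < 1) in Hy. now rewrite Rminus_0_r in Hy. }
  rewrite (is_pseries_unique _ _ _ (Ha _ Hy')).
  symmetry. apply is_pseries_unique, Hb, Hy'.
Qed.

Lemma has_expansion_unique (a b : nat -> C) f :
  has_expansion a f -> has_expansion b f -> forall n, a n = b n.
Proof.
intros Ha Hb n. apply injective_projections.
- apply (pseries_unique (fun n => Re (a n)) (fun n => Re (b n)) (fun x => Re (f x)));
    intros x Hx; now apply has_expansion_real.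
- apply (pseries_unique (fun n => Im (a n)) (fun n => Im (b n)) (fun x => Im (f x)));
    intros x Hx; now apply has_expansion_real.
Qed.

(** Frees later arguments from the choice operator: any expansion at hand may stand for
    [coeffs f]. *)
Lemma coeffs_eq (a : nat -> C) f : has_expansion a f -> forall n, coeffs f n = a n.
Proof.
intros H. apply has_expansion_unique with f; [|exact H].
unfold coeffs. apply ClassicalEpsilon.epsilon_spec. now exists a.
Qed.

Lemma zmul_expansion (a : nat -> C) f :
  has_expansion a f -> has_expansion (PS_incr_1 a) (zmul f).
Proof. intros H z Hz. apply (is_pseries_incr_1 a z (f z)), H, Hz. Qed.

Lemma ex_series_ratio (a : nat -> R) (q : R) (N : nat) :
  (forall n, 0 <= a n) -> 0 <= q < 1 ->
  (forall n, (N <= n)%nat -> a (S n) <= q * a n) -> ex_series a.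
Proof.
intros Ha Hq H. apply (ex_series_incr_n a N).
apply (@ex_series_le R_AbsRing R_CompleteNormedModule _ (fun k => q ^ k * a N)).
- intros k. change (Rabs (a (N + k)%nat) <= q ^ k * a N).
  rewrite Rabs_pos_eq by apply Ha.
  induction k as [|k IH].
  + rewrite Nat.add_0_r. simpl. lra.
  + rewrite Nat.add_succ_r. eapply Rle_trans; [apply H; lia|].
    simpl. rewrite Rmult_assoc. apply Rmult_le_compat_l; [lra|exact IH].
- apply ex_series_scal_r, ex_series_geom. rewrite Rabs_pos_eq; lra.
Qed.

Lemma ex_series_le_R (a b : nat -> R) :
  (forall n, Rabs (a n) <= b n) -> ex_series b -> ex_series a.
Proof. exact (@ex_series_le R_AbsRing R_CompleteNormedModule a b). Qed.

Lemma ex_series_scal_R (c : R) (a : nat -> R) :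
  ex_series a -> ex_series (fun n => c * a n).
Proof. exact (@ex_series_scal_l R_AbsRing R_NormedModule c a). Qed.

Lemma im_le_Cmod (c : C) : Rabs (Im c) <= Cmod c.
Proof. eapply Rle_trans; [apply Rmax_r|apply Rmax_Cmod]. Qed.

Lemma is_series_single {K : AbsRing} {V : NormedModule K} (m : nat) (v : V) :
  is_series (fun k => if Nat.eqb k m then v else zero) v.
Proof.
assert (L : forall n, (n < m)%nat ->
  sum_n (fun k => if Nat.eqb k m then v else zero) n = zero).
{ induction n as [|n IH]; intros Hn.
  - rewrite sum_O. destruct (Nat.eqb_spec 0 m); [lia|reflexivity].
  - rewrite sum_Sn, IH by lia. destruct (Nat.eqb_spec (S n) m); [lia|apply plus_zero_l]. }
assert (G : forall d, sum_n (fun k => if Nat.eqb k m then v else zero) (m + d) = v).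
{ induction d as [|d IH].
  - rewrite Nat.add_0_r. destruct m as [|m].
    + rewrite sum_O. reflexivity.
    + rewrite sum_Sn, L, Nat.eqb_refl by lia. apply plus_zero_l.
  - rewrite Nat.add_succ_r, sum_Sn, IH.
    destruct (Nat.eqb_spec (S (m + d)) m); [lia|apply plus_zero_r]. }
unfold is_series. apply filterlim_ext_loc with (fun _ => v); [|apply filterlim_const].
exists m. intros n Hn. symmetry. replace n with (m + (n - m))%nat by lia. apply G.
Qed.

Lemma term_le_Series (a : nat -> R) (m : nat) :
  (forall n, 0 <= a n) -> ex_series a -> a m <= Series a.
Proof.
intros Ha H.
rewrite <- (is_series_unique _ _ (@is_series_single R_AbsRing R_NormedModule m (a m))).
apply Series_le; [|exact H]. intros n.
destruct (Nat.eqb_spec n m) as [->|_]; split; try apply Ha; apply Rle_refl.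
Qed.

Lemma CSeries_correct (a : nat -> C) :
  ex_series (fun n => Cmod (a n)) -> is_series a (CSeries a).
Proof.
intros H. apply is_series_C. split; apply Series_correct;
  apply ex_series_le_R with (2 := H); intros n; [apply re_le_Cmod|apply im_le_Cmod].
Qed.

(** Projecting on the direction of the sum S gives |S|^2 = sum of Re (a_n conj S) <= |S| times the
    sum of |a_n|. *)
Lemma Cmod_CSeries_le (a : nat -> C) :
  ex_series (fun n => Cmod (a n)) -> Cmod (CSeries a) <= Series (fun n => Cmod (a n)).
Proof.
intros H. pose proof (CSeries_correct a H) as HS.
set (S := CSeries a) in *. apply is_series_C in HS. destruct HS as [HR HI].
assert (E : is_series (fun n => Re S * Re (a n) + Im S * Im (a n)) (Cmod S ^ 2)).
{ replace (Cmod S ^ 2) with (Re S * Re S + Im S * Im S).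
  - apply (is_series_plus (fun n => Re S * Re (a n)) (fun n => Im S * Im (a n)));
    now apply (@is_series_scal R_AbsRing R_NormedModule).
  - unfold Cmod. rewrite pow2_sqrt; [unfold Re, Im; ring|].
    apply Rplus_le_le_0_compat; apply pow2_ge_0. }
assert (B : forall n, Rabs (Re S * Re (a n) + Im S * Im (a n)) <= Cmod S * Cmod (a n)).
{ intros n. rewrite <- (Cmod_conj (a n)), <- Cmod_mult.
  eapply Rle_trans; [|apply re_le_Cmod]. right. f_equal.
  unfold Re, Im; simpl. ring. }
assert (X : ex_series (fun n => Cmod S * Cmod (a n))) by now apply ex_series_scal_R.
assert (Le : Cmod S ^ 2 <= Cmod S * Series (fun n => Cmod (a n))).
{ rewrite <- Series_scal_l, <- (is_series_unique _ _ E).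
  eapply Rle_trans; [apply Rle_abs|]. eapply Rle_trans; [apply Series_Rabs|].
  - apply ex_series_le_R with (2 := X). intros n. now rewrite Rabs_Rabsolu.
  - apply Series_le; [|exact X]. intros n. split; [apply Rabs_pos|apply B]. }
destruct (Rle_lt_or_eq_dec 0 (Cmod S) (Cmod_ge_0 _)) as [Hp|Hz].
- apply Rmult_le_reg_l with (1 := Hp). simpl in Le. lra.
- rewrite <- Hz. eapply Rle_trans; [apply (Cmod_ge_0 (a O))|].
  apply (term_le_Series (fun n => Cmod (a n)) 0); [intros n; apply Cmod_ge_0|exact H].
Qed.

Lemma has_expansion_CSeries (a : nat -> C) :
  ex_series (fun n => Cmod (a n)) ->
  has_expansion a (fun z => CSeries (fun n => (a n * z ^ n)%C)).
Proof.
intros H z Hz. unfold is_pseries.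
apply (is_series_ext (fun n => (a n * z ^ n)%C)).
- intros n. exact (Cmult_comm _ _).
- apply CSeries_correct, ex_series_le_R with (2 := H). intros n.
  rewrite Rabs_pos_eq by apply Cmod_ge_0. rewrite Cmod_mult, Cmod_pow.
  rewrite <- (Rmult_1_r (Cmod (a n))) at 2.
  apply Rmult_le_compat_l; [apply Cmod_ge_0|].
  rewrite <- (pow1 n). apply pow_incr. split; [apply Cmod_ge_0|lra].
Qed.

(** Each row has at most two nonzero entries, so the image exists for every sequence,
    square-summable or not. *)
Lemma jacobi_image (w : nat -> R) (x : nat -> C) :
  mat_image (jacobi w) x (fun i =>
    RtoC (sqrt (w (S i) / w (S (S i)))) * x (S i) +
    match i with O => 0 | S j => RtoC (sqrt (w (S j) / w (S (S j)))) * x j end)%C.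
Proof.
intros i. destruct i as [|j].
- rewrite Cplus_0_r.
  eapply is_series_ext; [|apply (is_series_single 1)].
  intros k. unfold jacobi. simpl. destruct k as [|[|k]]; simpl; [|reflexivity|];
  symmetry; apply Cmult_0_l.
- eapply is_series_ext;
    [|apply (@is_series_plus C_AbsRing C_NormedModule);
      [apply (is_series_single (S (S j)))|apply (is_series_single j)]].
  intros k. cbv beta. unfold jacobi.
  change (Nat.eqb (S k) (S (S (S j)))) with (Nat.eqb k (S (S j))).
  change (Nat.eqb (S (S j)) (S (S k))) with (Nat.eqb j k).
  rewrite (Nat.eqb_sym j k).
  destruct (Nat.eqb_spec k (S (S j))) as [->|H1].
  + destruct (Nat.eqb_spec (S (S j)) j) as [|_]; [lia|]. exact (plus_zero_r _).
  + destruct (Nat.eqb_spec k j) as [->|H2].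
    * exact (plus_zero_l _).
    * rewrite Cmult_0_l. exact (plus_zero_r _).
Qed.

(** * Bounds for the Jacobi matrix *)

Lemma is_series_C_unique (a : nat -> C) (l l' : C) :
  is_series a l -> is_series a l' -> l = l'.
Proof. exact (filterlim_locally_unique _ l l'). Qed.

Lemma mat_image_unique A x y y' : mat_image A x y -> mat_image A x y' -> forall i, y i = y' i.
Proof.
intros H H' i. exact (is_series_C_unique _ _ _ (H i) (H' i)).
Qed.

Lemma orthopoly_SS (w : nat -> R) (n : nat) (x : R) :
  orthopoly w (S (S n)) x =
  x * orthopoly w (S n) x - w (S n) / w (S (S n)) * orthopoly w n x.
Proof. reflexivity. Qed.

Lemma orthopoly_1 (w : nat -> R) (x : R) : orthopoly w 1 x = x.
Proof. simpl. ring. Qed.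

Definition orthoratio (w : nat -> R) (x : R) (n : nat) : R :=
  orthopoly w (S n) x / orthopoly w n x.

Lemma orthoratio_pos w x n :
  (forall k, 0 < orthopoly w k x) -> 0 < orthoratio w x n.
Proof. intros H. now apply Rdiv_lt_0_compat. Qed.

Lemma orthoratio_0 w x : orthoratio w x 0 = x.
Proof. unfold orthoratio. rewrite orthopoly_1. simpl. field. Qed.

Lemma orthoratio_S w x n :
  (forall k, 0 < orthopoly w k x) ->
  orthoratio w x (S n) = x - w (S n) / w (S (S n)) / orthoratio w x n.
Proof.
intros H. unfold orthoratio. rewrite orthopoly_SS.
pose proof (H n). pose proof (H (S n)).
set (c := w (S n) / w (S (S n))). field. lra.
Qed.

Lemma orthoratio_le w x n :
  (forall k, 0 < w k) -> (forall k, 0 < orthopoly w k x) -> orthoratio w x n <= x.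
Proof.
intros Hw H. destruct n as [|n].
- rewrite orthoratio_0. lra.
- rewrite orthoratio_S by exact H.
  enough (0 < w (S n) / w (S (S n)) / orthoratio w x n) by lra.
  apply Rdiv_lt_0_compat; [now apply Rdiv_lt_0_compat|now apply orthoratio_pos].
Qed.

(** Both weights lie in [0, x]. *)
Lemma ex_series_orthoratio w x (u : nat -> R) :
  (forall k, 0 < w k) -> (forall k, 0 < orthopoly w k x) ->
  (forall n, 0 <= u n) -> ex_series u ->
  ex_series (fun n => orthoratio w x n * u n) /\
  ex_series (fun n => (x - orthoratio w x n) * u n).
Proof.
intros Hw H Hu E.
assert (B : forall n, 0 <= orthoratio w x n <= x).
{ intros n. split; [left; now apply orthoratio_pos|now apply orthoratio_le]. }
split; (apply ex_series_le_R with (fun n => x * u n); [|now apply ex_series_scal_R]);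
  intros n; specialize (B n); specialize (Hu n);
  (rewrite Rabs_pos_eq;
   [apply Rmult_le_compat_r; lra|apply Rmult_le_pos; lra]).
Qed.

(** The weights at each index add up to x, and the second sum may start at n = 1 because rho_0 = x
    makes its term at 0 vanish. Schur's test and the bound on the quotient both rest on this
    identity. *)
Lemma Series_orthoratio w x (u : nat -> R) :
  (forall k, 0 < w k) -> (forall k, 0 < orthopoly w k x) ->
  (forall n, 0 <= u n) -> ex_series u ->
  Series (fun n => orthoratio w x n * u n) +
  Series (fun n => (x - orthoratio w x (S n)) * u (S n)) = x * Series u.
Proof.
intros Hw H Hu E. destruct (ex_series_orthoratio w x u Hw H Hu E) as [E1 E2].
rewrite <- (Series_incr_1_aux (fun n => (x - orthoratio w x n) * u n)).
- rewrite <- Series_plus by assumption. rewrite <- Series_scal_l.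
  apply Series_ext. intros n. ring.
- rewrite orthoratio_0. ring.
Qed.

(** Lagrange's identity: the difference of the two sides is a square divided by r r'. *)
Lemma weighted_cauchy_schwarz (r r' b b' s t : R) :
  0 < r -> 0 < r' ->
  (b * s + b' * t) ^ 2 <= (r + b' ^ 2 / r') * (b ^ 2 / r * s ^ 2 + r' * t ^ 2).
Proof.
intros Hr Hr'.
enough (0 <= (r + b' ^ 2 / r') * (b ^ 2 / r * s ^ 2 + r' * t ^ 2) - (b * s + b' * t) ^ 2) by lra.
replace (_ - _) with ((r * r' * t - b * b' * s) ^ 2 / (r * r')) by (field; lra).
apply Rdiv_le_0_compat; [apply pow2_ge_0|now apply Rmult_lt_0_compat].
Qed.

(** Repeats the set inside [opnorm] verbatim, so that [Glb_Rbar (op_bound A)] is convertible with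
    [opnorm A]. *)
Definition op_bound (A : nat -> nat -> R) (M : R) : Prop :=
  0 <= M /\
  forall x, l2 x -> exists y, mat_image A x y /\ l2 y /\ l2norm y <= M * l2norm x.

(* Schur's test (weighted Cauchy-Schwarz) with the positive vector [orthopoly w n M * sqrt (w (S n))]. *)
Lemma op_bound_of_orthopoly_pos w M :
  (forall k, 0 < w k) -> 0 < M -> (forall k, 0 < orthopoly w k M) ->
  op_bound (jacobi w) M.
Proof.
intros Hw HM HP. split; [lra|]. intros x Hx.
eexists. split; [apply jacobi_image|].
set (y := fun i : nat => _).
set (u := fun n => Cmod (x n) ^ 2).
assert (Hu : forall n, 0 <= u n) by (intros n; apply pow2_ge_0).
change (ex_series u) in Hx.
destruct (ex_series_orthoratio w M u Hw HP Hu Hx) as [E1 E2].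
(* [M * (A n + D n)] is the weighted Cauchy-Schwarz bound for row [n]: by the recurrence the first
   factor is [M], and [A n] and [D n] are the two terms of the second. [D 0 = 0] because the first
   row has no left neighbour. *)
set (D := fun n => match n with O => 0 | S m => orthoratio w M m * u m end).
set (A := fun n => (M - orthoratio w M (S n)) * u (S n)).
assert (EA : ex_series A) by exact (proj1 (ex_series_incr_1 _) E2).
assert (ED : ex_series D) by (apply ex_series_incr_1; exact E1).
assert (EG : ex_series (fun n => M * (A n + D n))).
{ apply ex_series_scal_R. now apply (@ex_series_plus R_AbsRing R_NormedModule). }
assert (SG : Series (fun n => M * (A n + D n)) = M ^ 2 * Series u).
{ rewrite Series_scal_l, Series_plus by assumption.
  rewrite (Series_incr_1_aux D) by reflexivity.
  pose proof (Series_orthoratio w M u Hw HP Hu Hx) as SO.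
  change (Series (fun n => orthoratio w M n * u n) + Series A = M * Series u) in SO.
  change (Series (fun k => D (S k))) with (Series (fun n => orthoratio w M n * u n)).
  rewrite Rplus_comm, SO. ring. }
assert (Le : forall n, Cmod (y n) ^ 2 <= M * (A n + D n)).
{ intros n.
  assert (RN : 0 < orthoratio w M n) by now apply orthoratio_pos.
  assert (Sq : forall i, sqrt (w i / w (S i)) ^ 2 = w i / w (S i)).
  { intros i. apply pow2_sqrt. left. now apply Rdiv_lt_0_compat. }
  unfold A. rewrite orthoratio_S by exact HP.
  replace (M - (M - _)) with (w (S n) / w (S (S n)) / orthoratio w M n) by ring.
  rewrite <- Sq. set (b := sqrt (w (S n) / w (S (S n)))).
  assert (Hb : 0 <= b) by apply sqrt_pos.
  destruct n as [|n].
  (* In the first row rho_0 = M makes the bound an equality. *)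
  - unfold D, y. fold b. rewrite Cplus_0_r, Cmod_mult, Cmod_R, Rabs_pos_eq by exact Hb.
    rewrite orthoratio_0. unfold u. right. field. lra.
  - assert (RN' : 0 < orthoratio w M n) by now apply orthoratio_pos.
    assert (EM : M = orthoratio w M (S n) + sqrt (w (S n) / w (S (S n))) ^ 2 / orthoratio w M n).
    { rewrite Sq, orthoratio_S by exact HP. ring. }
    set (b' := sqrt (w (S n) / w (S (S n)))) in *.
    assert (Hb' : 0 <= b') by apply sqrt_pos.
    unfold D, u. rewrite EM at 1.
    eapply Rle_trans; [|now apply weighted_cauchy_schwarz].
    apply pow_incr. split; [apply Cmod_ge_0|].
    eapply Rle_trans; [apply Cmod_triangle|].
    fold b b'. rewrite !Cmod_mult, !Cmod_R, !Rabs_pos_eq by assumption. apply Rle_refl. }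
assert (Pos : forall n, 0 <= Cmod (y n) ^ 2) by (intros n; apply pow2_ge_0).
split.
- apply ex_series_le_R with (2 := EG). intros n. now rewrite Rabs_pos_eq.
- unfold l2norm. change (Series (fun n => Cmod (x n) ^ 2)) with (Series u).
  rewrite <- (sqrt_pow2 M) by lra. rewrite <- sqrt_mult_alt by apply pow2_ge_0.
  apply sqrt_le_1_alt. rewrite <- SG. now apply Series_le.
Qed.

(* The truncation of the positive vector [orthopoly w k L * sqrt (w (S k))] at
   [k = N] is expanded by at least [L] in the rows up to [N], and row [N + 1] of
   its image is an extra nonzero entry; hence the strict inequality. *)
Lemma op_bound_truncation w M L N :
  (forall k, 0 < w k) -> 0 <= L ->
  (forall k, (k <= N)%nat -> 0 < orthopoly w k L) -> orthopoly w (S N) L <= 0 ->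
  op_bound (jacobi w) M -> L < M.
Proof.
intros Hw HL HP HN [HM HB].
set (p := fun k => if Nat.leb k N then orthopoly w k L * sqrt (w (S k)) else 0).
assert (Hs : forall k, 0 < sqrt (w k)) by (intros k; now apply sqrt_lt_R0).
assert (p_le : forall k, (k <= N)%nat -> p k = orthopoly w k L * sqrt (w (S k))).
{ intros k Hk. unfold p. now rewrite (proj2 (Nat.leb_le _ _) Hk). }
assert (p_gt : forall k, (N < k)%nat -> p k = 0).
{ intros k Hk. unfold p. now rewrite (proj2 (Nat.leb_gt _ _) Hk). }
assert (p_pos : forall k, 0 <= p k).
{ intros k. destruct (le_lt_dec k N) as [Hk|Hk].
  - rewrite p_le by exact Hk. specialize (HP k Hk). specialize (Hs (S k)).
    apply Rmult_le_pos; lra.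
  - rewrite p_gt by exact Hk. lra. }
set (b := fun i => sqrt (w (S i) / w (S (S i)))).
(* This relation turns the symmetric matrix into the monic recurrence of [orthopoly]. *)
assert (bs : forall i, b i * sqrt (w (S (S i))) = sqrt (w (S i))).
{ intros i. unfold b. rewrite <- sqrt_mult_alt.
  - f_equal. field. apply Rgt_not_eq, Hw.
  - left. now apply Rdiv_lt_0_compat. }
assert (b_pos : forall i, 0 < b i).
{ intros i. apply sqrt_lt_R0. now apply Rdiv_lt_0_compat. }
assert (b_sq : forall i, b i ^ 2 = w (S i) / w (S (S i))).
{ intros i. apply pow2_sqrt. left. now apply Rdiv_lt_0_compat. }
assert (El : ex_series (fun k => p k ^ 2)).
{ apply (ex_series_incr_n _ (S N)). exists 0.
  apply (is_series_ext (fun k => if Nat.eqb k 0 then 0 else 0)).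
  - intros k. rewrite p_gt by lia. destruct (Nat.eqb k 0); simpl; ring.
  - apply (@is_series_single R_AbsRing R_NormedModule 0 0). }
assert (El2 : ex_series (fun k => Cmod (RtoC (p k)) ^ 2)).
{ revert El. apply ex_series_ext. intros k. rewrite Cmod_R, pow2_abs. reflexivity. }
destruct (HB (fun k => RtoC (p k)) El2) as (y & Hy & y_l2 & y_norm).
set (q := fun i => b i * p (S i) + match i with O => 0 | S j => b j * p j end).
assert (Hq : forall i, y i = RtoC (q i)).
{ intros i. rewrite (mat_image_unique _ _ _ _ Hy (jacobi_image _ _) i).
  unfold q. rewrite RtoC_plus, RtoC_mult. destruct i; [reflexivity|].
  now rewrite RtoC_mult. }
assert (q_ge : forall i, (i <= N)%nat -> L * p i <= q i).
{ intros i Hi.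
  assert (A : orthopoly w (S i) L * sqrt (w (S i)) <= b i * p (S i)).
  { destruct (le_lt_dec (S i) N) as [Hk|Hk].
    - rewrite p_le by exact Hk. rewrite <- (bs i). lra.
    (* In row [N] the right neighbour is cut off, and the sign of P_(N+1)(L) gives the inequality;
       in earlier rows it is an equality. *)
    - rewrite p_gt by exact Hk. replace i with N by lia.
      specialize (Hs (S N)). rewrite Rmult_0_r.
      apply Rmult_le_reg_r with (/ sqrt (w (S N))); [now apply Rinv_0_lt_compat|].
      rewrite Rmult_assoc, Rinv_r; lra. }
  unfold q. rewrite (p_le i Hi). destruct i as [|i].
  - rewrite orthopoly_1 in A. simpl in *. lra.
  - rewrite orthopoly_SS in A. rewrite (p_le i) by lia.
    assert (Bi : b i * (orthopoly w i L * sqrt (w (S i))) =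
      w (S i) / w (S (S i)) * orthopoly w i L * sqrt (w (S (S i)))).
    { rewrite <- (bs i), <- b_sq. ring. }
    rewrite Bi. lra. }
assert (q_N : 0 < q (S N)).
{ unfold q. rewrite p_gt, p_le by lia. rewrite Rmult_0_r, Rplus_0_l.
  apply Rmult_lt_0_compat; [apply b_pos|].
  apply Rmult_lt_0_compat; [now apply HP|apply Hs]. }
set (g := fun n => if Nat.eqb n (S N) then q (S N) ^ 2 else 0).
assert (Hg : is_series g (q (S N) ^ 2))
  by apply (@is_series_single R_AbsRing R_NormedModule).
assert (Low : L ^ 2 * Series (fun k => p k ^ 2) + q (S N) ^ 2 <= Series (fun k => Cmod (y k) ^ 2)).
{ rewrite <- Series_scal_l, <- (is_series_unique _ _ Hg), <- Series_plus.
  2: now apply ex_series_scal_R.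
  2: now exists (q (S N) ^ 2).
  apply Series_le; [|exact y_l2]. intros n. rewrite Hq, Cmod_R, pow2_abs. unfold g.
  assert (G : 0 <= L ^ 2 * p n ^ 2) by (apply Rmult_le_pos; apply pow2_ge_0).
  destruct (Nat.eqb_spec n (S N)) as [->|Hn].
  - rewrite p_gt in * by lia. pose proof (pow2_ge_0 (q (S N))). split; lra.
  - split; [lra|]. rewrite Rplus_0_r. destruct (le_lt_dec n N) as [Hk|Hk].
    + rewrite <- Rpow_mult_distr. apply pow_incr. split; [|now apply q_ge].
      now apply Rmult_le_pos.
    + rewrite p_gt by exact Hk. pose proof (pow2_ge_0 (q n)). lra. }
assert (Up : Series (fun k => Cmod (y k) ^ 2) <= M ^ 2 * Series (fun k => p k ^ 2)).
{ assert (Nn : forall a : nat -> R, (forall n, 0 <= a n) -> ex_series a -> 0 <= Series a).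
  { intros a Ha Ea. apply Rle_trans with (a O); [apply Ha|now apply term_le_Series]. }
  unfold l2norm in y_norm.
  rewrite (Series_ext (fun n => Cmod (RtoC (p n)) ^ 2) (fun k => p k ^ 2)) in y_norm
    by (intros k; now rewrite Cmod_R, pow2_abs).
  rewrite <- (pow2_sqrt (Series (fun k => Cmod (y k) ^ 2))).
  2: apply Nn; [intros n; apply pow2_ge_0|exact y_l2].
  rewrite <- (pow2_sqrt (Series (fun k => p k ^ 2))).
  2: apply Nn; [intros n; apply pow2_ge_0|exact El].
  rewrite <- Rpow_mult_distr. apply pow_incr. split; [apply sqrt_pos|exact y_norm]. }
(* If M <= L, then [Low] and [Up] leave no room for the positive extra entry [q (S N)]. *)
destruct (Rlt_le_dec L M) as [H|H]; [exact H|exfalso].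
assert (M ^ 2 <= L ^ 2) by (apply pow_incr; lra).
assert (0 <= Series (fun k => p k ^ 2)).
{ apply Rle_trans with (p O ^ 2); [apply pow2_ge_0|].
  apply (term_le_Series (fun k => p k ^ 2)); [intros n; apply pow2_ge_0|exact El]. }
assert (0 < q (S N) ^ 2) by now apply pow_lt.
assert (M ^ 2 * Series (fun k => p k ^ 2) <= L ^ 2 * Series (fun k => p k ^ 2))
  by now apply Rmult_le_compat_r.
lra.
Qed.

(** The image of [x] does not depend on the bound, so [M] can approach [L] in the norm
    inequality. *)
Lemma op_bound_closed w L :
  0 <= L -> (forall e, 0 < e -> exists M, M < L + e /\ op_bound (jacobi w) M) ->
  op_bound (jacobi w) L.
Proof.
intros HL H. split; [exact HL|]. intros x Hx. eexists.
split; [apply jacobi_image|]. set (y := fun i : nat => _).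
assert (B : forall M, op_bound (jacobi w) M -> l2 y /\ l2norm y <= M * l2norm x).
{ intros M [_ HM]. destruct (HM x Hx) as (z & Hz & z_l2 & z_norm).
  assert (E : forall i, Cmod (z i) ^ 2 = Cmod (y i) ^ 2).
  { intros i. now rewrite (mat_image_unique _ _ _ _ Hz (jacobi_image w x) i). }
  unfold l2norm in *. rewrite (Series_ext _ _ E) in z_norm.
  split; [|exact z_norm]. revert z_l2. now apply ex_series_ext. }
split.
- destruct (H 1 Rlt_0_1) as (M & _ & HM). now apply (B M).
- apply le_epsilon. intros e He.
  assert (0 <= l2norm x) by apply sqrt_pos.
  (* Adding 1 keeps the denominator positive when [x] vanishes. *)
  assert (Hd : 0 < e / (l2norm x + 1)) by (apply Rdiv_lt_0_compat; lra).
  destruct (H _ Hd) as (M & HM & HMb).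
  eapply Rle_trans; [now apply (B M)|].
  apply Rle_trans with ((L + e / (l2norm x + 1)) * l2norm x).
  + apply Rmult_le_compat_r; lra.
  + replace e with (e / (l2norm x + 1) * (l2norm x + 1)) at 2 by (field; lra).
    lra.
Qed.

(** A single bound makes the infimum finite, and closedness of the set of bounds makes it a
    minimum. *)
Lemma opnorm_jacobi w M0 :
  op_bound (jacobi w) M0 ->
  is_finite (opnorm (jacobi w)) /\
  op_bound (jacobi w) (real (opnorm (jacobi w))) /\
  forall M, op_bound (jacobi w) M -> real (opnorm (jacobi w)) <= M.
Proof.
intros H0.
destruct (Glb_Rbar_correct (op_bound (jacobi w))) as [Lb Gr].
change (Glb_Rbar (op_bound (jacobi w))) with (opnorm (jacobi w)) in *.
assert (Z : Rbar_le 0 (opnorm (jacobi w))).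
{ apply Gr. intros M [HM _]. exact HM. }
pose proof (Lb M0 H0) as U.
destruct (opnorm (jacobi w)) as [L| |]; simpl in Z, U; try contradiction.
split; [reflexivity|]. split; [|exact Lb].
apply op_bound_closed; [exact Z|]. intros e He. apply Classical_Prop.NNPP. intros Hn.
assert (Rbar_le (L + e) L).
{ apply Gr. intros M HM. simpl. destruct (Rlt_le_dec M (L + e)) as [A|A]; [|exact A].
  exfalso. apply Hn. now exists M. }
simpl in H. lra.
Qed.

(** At the first index with a nonpositive value, [op_bound_truncation] would yield L < L. *)
Lemma orthopoly_pos_of_op_bound w L :
  (forall k, 0 < w k) -> op_bound (jacobi w) L -> forall n, 0 < orthopoly w n L.
Proof.
intros Hw HL n. induction n as [n IH] using lt_wf_ind.
destruct n as [|n]; [simpl; lra|].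
apply Rnot_le_lt. intros Hn.
apply (Rlt_irrefl L), op_bound_truncation with w n; try assumption.
- apply HL.
- intros k Hk. apply IH. lia.
Qed.

(** The recurrence gives P_(m+2) >= x P_(m+1) - (x - 1) P_m >= P_(m+1). *)
Lemma orthopoly_increasing w x n :
  (forall k, 0 < w k) -> 0 < orthopoly w n x <= orthopoly w (S n) x ->
  (forall m, (n <= m)%nat -> w (S m) / w (S (S m)) <= x - 1) ->
  forall m, (n <= m)%nat -> 0 < orthopoly w m x <= orthopoly w (S m) x.
Proof.
intros Hw Hn Hc. induction 1 as [|m Hm IH]; [exact Hn|].
split; [lra|]. rewrite orthopoly_SS. specialize (Hc m Hm).
assert (w (S m) / w (S (S m)) * orthopoly w m x <= (x - 1) * orthopoly w (S m) x).
{ apply Rmult_le_compat; try lra. left. now apply Rdiv_lt_0_compat. }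
lra.
Qed.

(** With M = K + 1 all ratios are at most M - 1, so the values P_n(M) never fall below P_0 = 1 and
    Schur's test applies. *)
Lemma op_bound_exists w K :
  (forall k, 0 < w k) -> (forall n, w n / w (S n) <= K) -> op_bound (jacobi w) (K + 1).
Proof.
intros Hw HK.
assert (0 < K).
{ apply Rlt_le_trans with (2 := HK O). now apply Rdiv_lt_0_compat. }
apply op_bound_of_orthopoly_pos; [exact Hw|lra|]. intros k.
apply (orthopoly_increasing w (K + 1) 0); [exact Hw| | |lia].
- rewrite orthopoly_1. simpl. lra.
- intros m _. specialize (HK (S m)). lra.
Qed.

(** * Decay of the orthogonal polynomials at the norm *)

Lemma continuous_orthopoly w n x : continuous (orthopoly w n) x.
Proof.
induction n as [n IH] using lt_wf_ind. destruct n as [|[|n]].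
- apply continuous_const.
- apply (continuous_ext (fun x => x)); [|apply continuous_id].
  intros y. symmetry. apply orthopoly_1.
- apply (@continuous_minus R_UniformSpace R_AbsRing R_NormedModule
    (fun x => x * orthopoly w (S n) x)
    (fun x => w (S n) / w (S (S n)) * orthopoly w n x)).
  + apply (@continuous_mult R_UniformSpace R_AbsRing (fun x => x) (orthopoly w (S n))).
    * apply continuous_id.
    * apply IH. lia.
  + apply (@continuous_mult R_UniformSpace R_AbsRing (fun _ => w (S n) / w (S (S n)))).
    * apply continuous_const.
    * apply IH. lia.
Qed.

(** Each condition is open, and finitely many of them hold on a common neighbourhood. *)
Lemma locally_orthopoly_pos w L n :
  (forall k, 0 < orthopoly w k L) ->
  locally L (fun x => forall k, (k <= n)%nat -> 0 < orthopoly w k x).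
Proof.
intros H. induction n as [|n IH].
- apply filter_forall. intros x k Hk. replace k with O by lia. simpl. lra.
- assert (A : locally L (fun x => 0 < orthopoly w (S n) x)).
  { apply (continuous_orthopoly w (S n) L (fun y => 0 < y)), open_gt, H. }
  generalize (filter_and _ _ IH A). apply filter_imp. intros x [H1 H2] k Hk.
  destruct (Nat.eq_dec k (S n)) as [->|]; [exact H2|]. apply H1. lia.
Qed.

(* Otherwise the positivity of all [orthopoly w k] would persist slightly below
   [L], and Schur's test would give a smaller bound. *)
Lemma orthopoly_decreasing w L N :
  (forall k, 0 < w k) -> 2 < L -> (forall k, 0 < orthopoly w k L) ->
  (forall M, op_bound (jacobi w) M -> L <= M) ->
  (forall n, (N <= n)%nat -> w n / w (S n) <= L / 2) ->
  forall n, (N <= n)%nat -> orthopoly w (S n) L <= orthopoly w n L.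
Proof.
intros Hw HL HP Hmin Hc n Hn. apply Rnot_lt_le. intros Hlt.
assert (A : locally L (fun x => 0 < orthopoly w (S n) x - orthopoly w n x)).
{ apply (@continuous_minus R_UniformSpace R_AbsRing R_NormedModule
    (orthopoly w (S n)) (orthopoly w n) L
    (continuous_orthopoly w (S n) L) (continuous_orthopoly w n L) (fun y => 0 < y)).
  apply open_gt. change (0 < orthopoly w (S n) L - orthopoly w n L). lra. }
destruct (filter_and _ _ A (locally_orthopoly_pos w L n HP)) as [e He].
(* The bound [e / 2] keeps [L - d] inside the neighbourhood; the bound [L / 2 - 1] gives L / 2 <= (L
   - d) - 1, as [orthopoly_increasing] requires. *)
set (d := Rmin (e / 2) (L / 2 - 1)).
assert (D : 0 < d <= e / 2 /\ d <= L / 2 - 1).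
{ pose proof (cond_pos e). unfold d. split; [split|].
  - apply Rmin_pos; lra.
  - apply Rmin_l.
  - apply Rmin_r. }
destruct (He (L - d)) as [H1 H2].
{ change (Rabs (L - d - L) < e). rewrite Rabs_left; pose proof (cond_pos e); lra. }
assert (B : L <= L - d); [|lra].
apply Hmin, op_bound_of_orthopoly_pos; [exact Hw|lra|]. intros k.
(* Indices up to [n] are covered by the neighbourhood, later ones by growth from [n] onwards. *)
destruct (le_lt_dec k n) as [Hk|Hk]; [now apply H2|].
apply (orthopoly_increasing w (L - d) n); [exact Hw| | |lia].
- specialize (H2 n (le_n n)). lra.
- intros m Hm. specialize (Hc (S m)). assert (N <= S m)%nat by lia. specialize (Hc H). lra.
Qed.

(** With c = w_(n+1) / w_(n+2), the inequality P_(n+2) <= P_(n+1) reads (L - 1) P_(n+1) <= c P_n,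
    and c <= L / 2. *)
Lemma orthopoly_geometric w L N :
  (forall k, 0 < w k) -> 2 < L -> (forall k, 0 < orthopoly w k L) ->
  (forall M, op_bound (jacobi w) M -> L <= M) ->
  (forall n, (N <= n)%nat -> w n / w (S n) <= L / 2) ->
  forall n, (N <= n)%nat -> orthopoly w (S n) L <= L / (2 * (L - 1)) * orthopoly w n L.
Proof.
intros Hw HL HP Hmin Hc n Hn.
assert (A := orthopoly_decreasing w L N Hw HL HP Hmin Hc (S n)).
rewrite orthopoly_SS in A. specialize (A ltac:(lia)).
assert (B : w (S n) / w (S (S n)) * orthopoly w n L <= L / 2 * orthopoly w n L).
{ apply Rmult_le_compat_r; [left; apply HP|]. apply Hc. lia. }
apply Rmult_le_reg_l with (L - 1); [lra|].
replace ((L - 1) * (L / (2 * (L - 1)) * orthopoly w n L)) with (L / 2 * orthopoly w n L)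
  by (field; lra).
lra.
Qed.

Lemma bounded_prefix (a : nat -> R) N : exists K, forall n, (n < N)%nat -> a n <= K.
Proof.
induction N as [|N [K HK]]; [exists 0; intros n Hn; lia|].
exists (Rmax K (a N)). intros n Hn. destruct (Nat.eq_dec n N) as [->|]; [apply Rmax_r|].
eapply Rle_trans; [apply HK; lia|apply Rmax_l].
Qed.

Lemma bounded_of_lim (a : nat -> R) (l : R) : is_lim_seq a l -> exists K, forall n, a n <= K.
Proof.
intros H. destruct (H (fun y => y < l + 1)) as [N HN]; [apply open_lt; lra|].
destruct (bounded_prefix a N) as [K HK]. exists (Rmax K (l + 1)). intros n.
destruct (le_lt_dec N n) as [Hn|Hn].
- eapply Rle_trans; [left; now apply HN|apply Rmax_r].
- eapply Rle_trans; [now apply HK|apply Rmax_l].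
Qed.

(** * The quotient *)

Lemma CSeries_incr_1_aux (a : nat -> C) :
  a O = RtoC 0 -> CSeries a = CSeries (fun n => a (S n)).
Proof.
intros H. unfold CSeries.
rewrite (Series_incr_1_aux (fun n => Re (a n))), (Series_incr_1_aux (fun n => Im (a n)));
  try reflexivity; now rewrite H.
Qed.

(** Multiplication by z shifts the coefficients by one, so both series lose a vanishing first term
    and are reindexed. *)
Lemma quotient_coeffs w a f :
  has_expansion a f -> (forall n, 0 < w n) ->
  ex_series (fun n => Cmod (a n) ^ 2 * w (S n)) ->
  quotient w f =
  Cmod (CSeries (fun n => a (S n) * Cconj (a n) * RtoC (w (S n)))%C) /
  Series (fun n => Cmod (a n) ^ 2 * w (S n)).
Proof.
intros Hf Hw Hex. pose proof (zmul_expansion a f Hf) as Hz.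
assert (Ez := coeffs_eq _ _ Hz). assert (Ef := coeffs_eq _ _ Hf).
unfold quotient. f_equal.
- f_equal. unfold H2_inner. rewrite CSeries_incr_1_aux.
  + unfold CSeries. f_equal; apply Series_ext; intros n; now rewrite Ez, Ef.
  + rewrite Ez. simpl. unfold zero; simpl.
    unfold RtoC, Cconj, Cmult; simpl. f_equal; ring.
- f_equal. unfold H2_norm. rewrite Series_incr_1_aux.
  + rewrite pow2_sqrt.
    * apply Series_ext. intros n. now rewrite Ez.
    * apply Rle_trans with (Cmod (a O) ^ 2 * w 1%nat).
      -- apply Rmult_le_pos; [apply pow2_ge_0|left; apply Hw].
      -- rewrite (Series_ext _ (fun n => Cmod (a n) ^ 2 * w (S n)))
           by (intros n; now rewrite Ez).
         apply (term_le_Series (fun n => Cmod (a n) ^ 2 * w (S n))); [|exact Hex].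
         intros n. apply Rmult_le_pos; [apply pow2_ge_0|left; apply Hw].
  + rewrite Ez. change (PS_incr_1 a 0) with (RtoC 0). rewrite Cmod_0. ring.
Qed.

(** Eventually w_n / w_(n+1) > 1/2, that is, w_(n+1) < 2 w_n. Hence zf has finite norm whenever f
    has. *)
Lemma ex_series_weight_shift w (u : nat -> R) :
  (forall n, 0 < w n) -> is_lim_seq (fun n => w n / w (S n)) 1 ->
  (forall n, 0 <= u n) -> ex_series (fun n => u n * w n) ->
  ex_series (fun n => u n * w (S n)).
Proof.
intros Hw Hl Hu H.
destruct (Hl (fun y => / 2 < y)) as [N HN]; [apply open_gt; lra|].
apply (ex_series_incr_n _ N) in H. apply (ex_series_incr_n _ N).
apply ex_series_le_R with (fun n => 2 * (u (N + n)%nat * w (N + n)%nat)).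
- intros n. specialize (HN (N + n)%nat ltac:(lia)).
  pose proof (Hu (N + n)%nat). pose proof (Hw (N + n)%nat). pose proof (Hw (S (N + n))).
  rewrite Rabs_pos_eq by (apply Rmult_le_pos; lra).
  assert (w (S (N + n)) <= 2 * w (N + n)%nat).
  { apply Rmult_lt_compat_r with (r := w (S (N + n))) in HN; [|lra].
    replace (w (N + n)%nat / w (S (N + n)) * w (S (N + n))) with (w (N + n)%nat) in HN
      by (field; lra).
    lra. }
  replace (2 * (u (N + n)%nat * w (N + n)%nat)) with (u (N + n)%nat * (2 * w (N + n)%nat)) by ring.
  apply Rmult_le_compat_l; lra.
- now apply ex_series_scal_R.
Qed.

(** The arithmetic-geometric mean inequality is applied termwise with weight rho_n;
    [Series_orthoratio] then sums the upper bounds to L / 2 times the squared norm of zf. *)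
Lemma quotient_le w L f :
  (forall n, 0 < w n) -> is_lim_seq (fun n => w n / w (S n)) 1 ->
  (forall k, 0 < orthopoly w k L) ->
  H2 w f -> nonzero_on_disk f -> quotient w f <= L / 2.
Proof.
intros Hw Hl HP (a & Ha & Hex) (z & Hz & Hfz).
assert (Hu0 : forall n, 0 <= Cmod (a n) ^ 2) by (intros n; apply pow2_ge_0).
assert (Ex : ex_series (fun n => Cmod (a n) ^ 2 * w (S n)))
  by (apply ex_series_weight_shift; assumption).
rewrite (quotient_coeffs w a f) by assumption.
set (u := fun n => Cmod (a n) ^ 2 * w (S n)) in *.
assert (Hu : forall n, 0 <= u n).
{ intros n. apply Rmult_le_pos; [apply Hu0|left; apply Hw]. }
assert (Pos : 0 < Series u).
{ destruct (Classical_Prop.classic (exists n, a n <> RtoC 0)) as [[n Hn]|Hn].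
  - apply Rlt_le_trans with (u n); [|now apply term_le_Series].
    apply Rmult_lt_0_compat; [|apply Hw]. apply pow_lt. now apply Cmod_gt_0.
  (* If all coefficients vanish, [f z] is the sum of the zero series. *)
  - exfalso. apply Hfz. refine (is_series_C_unique _ _ _ (Ha z Hz) _).
    eapply is_series_ext; [|apply (@is_series_single C_AbsRing C_NormedModule 0 (RtoC 0))].
    intros n. cbv beta.
    assert (E : a n = RtoC 0) by (apply Classical_Prop.NNPP; intros E; apply Hn; now exists n).
    rewrite E. destruct (Nat.eqb n 0); symmetry; exact (Cmult_0_r _). }
set (t := fun n => Cmod (a (S n) * Cconj (a n) * RtoC (w (S n)))%C).
destruct (ex_series_orthoratio w L u Hw HP Hu Ex) as [E1 E2].
assert (E3 := proj1 (ex_series_incr_1 _) E2). cbv beta in E3.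
set (v := fun n => / 2 * (orthoratio w L n * u n + (L - orthoratio w L (S n)) * u (S n))).
assert (E4 : ex_series v).
{ apply ex_series_scal_R. now apply (@ex_series_plus R_AbsRing R_NormedModule). }
assert (Lt : forall n, 0 <= t n <= v n).
{ intros n. split; [apply Cmod_ge_0|].
  unfold t, v. rewrite !Cmod_mult, Cmod_conj, Cmod_R, Rabs_pos_eq by (left; apply Hw).
  rewrite orthoratio_S by exact HP.
  pose proof (orthoratio_pos w L n HP) as Hr. unfold u.
  pose proof (Hw (S n)). pose proof (Hw (S (S n))).
  set (r := orthoratio w L n) in *. set (s := Cmod (a (S n))). set (s' := Cmod (a n)).
  (* The upper bound exceeds the term by a multiple of a square, which vanishes when s = rho_n
     s'. *)
  replace (/ 2 * _) with (s * s' * w (S n) + / 2 * (w (S n) / r * (r * s' - s) ^ 2))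
    by (field; lra).
  enough (0 <= w (S n) / r * (r * s' - s) ^ 2) by lra.
  apply Rmult_le_pos; [|apply pow2_ge_0]. left. now apply Rdiv_lt_0_compat. }
assert (Et : ex_series t).
{ apply ex_series_le_R with (2 := E4). intros n. rewrite Rabs_pos_eq; apply Lt. }
apply Rmult_le_reg_r with (Series u); [exact Pos|].
unfold Rdiv at 1. rewrite Rmult_assoc, Rinv_l, Rmult_1_r by lra.
eapply Rle_trans; [apply Cmod_CSeries_le, Et|].
eapply Rle_trans; [apply (Series_le _ _ Lt E4)|].
unfold v. rewrite Series_scal_l, Series_plus by assumption.
rewrite (Series_orthoratio w L u) by assumption. lra.
Qed.

(** Here a_(n+1) = rho_n a_n, the equality case of the mean inequality: the two sums in
    [Series_orthoratio] coincide, so each is half of the total. *)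
Lemma quotient_orthopoly w L f :
  (forall n, 0 < w n) -> (forall k, 0 < orthopoly w k L) ->
  has_expansion (fun n => RtoC (orthopoly w n L)) f ->
  ex_series (fun n => orthopoly w n L ^ 2 * w (S n)) ->
  quotient w f = L / 2.
Proof.
intros Hw HP Hf Ex.
assert (E : forall n, Cmod (RtoC (orthopoly w n L)) ^ 2 * w (S n) = orthopoly w n L ^ 2 * w (S n)).
{ intros n. now rewrite Cmod_R, pow2_abs. }
rewrite (quotient_coeffs w _ f Hf Hw); cycle 1.
{ revert Ex. apply ex_series_ext. intros n. now rewrite E. }
rewrite (Series_ext _ _ E).
set (u := fun n => orthopoly w n L ^ 2 * w (S n)) in *.
assert (Hu : forall n, 0 < u n).
{ intros n. apply Rmult_lt_0_compat; [now apply pow_lt|apply Hw]. }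
assert (Hu' : forall n, 0 <= u n) by (intros n; left; apply Hu).
assert (Pos : 0 < Series u).
{ apply Rlt_le_trans with (u O); [apply Hu|now apply term_le_Series]. }
pose proof (Series_orthoratio w L u Hw HP Hu' Ex) as S1.
rewrite (Series_ext (fun n => (L - orthoratio w L (S n)) * u (S n))
  (fun n => orthoratio w L n * u n)) in S1.
2:{ intros n. rewrite orthoratio_S by exact HP. unfold u, orthoratio.
  pose proof (HP n). pose proof (HP (S n)). pose proof (Hw (S (S n))). field. lra. }
set (T := Series (fun n => orthoratio w L n * u n)) in *.
assert (ET : CSeries (fun n =>
  (RtoC (orthopoly w (S n) L) * Cconj (RtoC (orthopoly w n L)) * RtoC (w (S n)))%C) = RtoC T).
{ unfold CSeries. apply injective_projections; unfold fst, snd.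
  - apply Series_ext. intros n. pose proof (HP n). unfold orthoratio, u.
    generalize (orthopoly w (S n) L). intros p. simpl. field. lra.
  (* Writing the vanishing imaginary parts as [0 * 0] lets [Series_scal_l] evaluate their sum. *)
  - rewrite (Series_ext _ (fun n => 0 * 0)).
    + rewrite Series_scal_l, Rmult_0_l. reflexivity.
    + intros n. generalize (orthopoly w (S n) L). intros p. simpl. ring. }
rewrite ET, Cmod_R, Rabs_pos_eq.
- replace T with (L * Series u / 2) by lra. field. lra.
- assert (0 < L) by (rewrite <- (orthopoly_1 w L); apply HP).
  assert (0 < L * Series u) by now apply Rmult_lt_0_compat.
  lra.
Qed.

Theorem corollary4p5 (w : nat -> R)
  (w_pos : forall n, 0 < w n)
  (w_0 : w 0%nat = 1)
  (w_ratio : is_lim_seq (fun n => w n / w (S n)) 1)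
  (norm_gt2 : Rbar_lt 2 (opnorm (jacobi w))) :
  (exists f, extremal w f) /\
  has_expansion (fun n => RtoC (orthopoly w n (real (opnorm (jacobi w))))) (fstar w) /\
  extremal w (fstar w).

Proof.
destruct (bounded_of_lim _ _ w_ratio) as [K HK].
destruct (opnorm_jacobi w _ (op_bound_exists w K w_pos HK)) as (Fin & HL & Hmin).
rewrite <- Fin in norm_gt2. simpl in norm_gt2. unfold fstar.
set (L := real (opnorm (jacobi w))) in *.
assert (HP := orthopoly_pos_of_op_bound w L w_pos HL).
(* The decay factor of [orthopoly_geometric]; q < 1 amounts to L > 2. *)
set (q := L / (2 * (L - 1))).
assert (Hq : 0 < q < 1).
{ unfold q. split.
  - apply Rdiv_lt_0_compat; lra.
  - apply Rmult_lt_reg_r with (2 * (L - 1)); [lra|].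
    unfold Rdiv. rewrite Rmult_assoc, Rinv_l; lra. }
destruct (w_ratio (fun y => y < L / 2)) as [N1 HN1]; [apply open_lt; lra|].
(* Since q < 1, eventually q w_(n+1) < w_n. Passing from P_n^2 w_n to the next term, one factor of
   q^2 absorbs the change of weight and the other remains as the ratio. *)
destruct (w_ratio (fun y => q < y)) as [N2 HN2]; [apply open_gt; lra|].
assert (Geo := orthopoly_geometric w L N1 w_pos norm_gt2 HP Hmin
  (fun n Hn => Rlt_le _ _ (HN1 n Hn))). fold q in Geo.
set (F := fun z : C => CSeries (fun n => (RtoC (orthopoly w n L) * z ^ n)%C)).
assert (Exp : has_expansion (fun n => RtoC (orthopoly w n L)) F).
{ apply (has_expansion_CSeries (fun n => RtoC (orthopoly w n L))).
  apply (ex_series_ext (fun n => orthopoly w n L)).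
  - intros n. rewrite Cmod_R, Rabs_pos_eq; [reflexivity|left; apply HP].
  - apply ex_series_ratio with q N1; [intros n; left; apply HP|lra|exact Geo]. }
assert (Ex : ex_series (fun n => orthopoly w n L ^ 2 * w n)).
{ apply ex_series_ratio with q (Nat.max N1 N2); [|lra|].
  - intros n. apply Rmult_le_pos; [apply pow2_ge_0|left; apply w_pos].
  - intros n Hn. specialize (Geo n ltac:(lia)). specialize (HN2 n ltac:(lia)).
    pose proof (w_pos n). pose proof (w_pos (S n)).
    apply Rmult_lt_compat_r with (r := w (S n)) in HN2; [|lra].
    replace (w n / w (S n) * w (S n)) with (w n) in HN2 by (field; lra).
    apply Rle_trans with ((q * orthopoly w n L) ^ 2 * w (S n)).
    + apply Rmult_le_compat_r; [lra|]. apply pow_incr. split; [left; apply HP|exact Geo].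
    + replace ((q * orthopoly w n L) ^ 2 * w (S n))
        with (q * orthopoly w n L ^ 2 * (q * w (S n))) by ring.
      rewrite <- (Rmult_assoc q _ (w n)). apply Rmult_le_compat_l; [|lra].
      apply Rmult_le_pos; [lra|apply pow2_ge_0]. }
assert (HF : H2 w F).
{ exists (fun n => RtoC (orthopoly w n L)). split; [exact Exp|].
  revert Ex. apply ex_series_ext. intros n. now rewrite Cmod_R, pow2_abs. }
assert (NF : nonzero_on_disk F).
(* At 0 only the constant term P_0 = 1 survives. *)
{ exists (RtoC 0). split; [rewrite Cmod_0; lra|].
  assert (E0 : F (RtoC 0) = RtoC 1).
  { assert (Cmod (RtoC 0) < 1) as H0 by (rewrite Cmod_0; lra).
    refine (is_series_C_unique _ _ _ (Exp _ H0) _).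
    eapply is_series_ext; [|apply (@is_series_single C_AbsRing C_NormedModule 0 (RtoC 1))].
    intros n. cbv beta.
    destruct n as [|n]; symmetry.
    - exact (Cmult_1_l _).
    - change ((RtoC 0 * RtoC 0 ^ n) * RtoC (orthopoly w (S n) L) = RtoC 0)%C. ring. }
  rewrite E0. exact C1_nz. }
assert (QF : quotient w F = L / 2).
{ apply quotient_orthopoly; try assumption.
  apply ex_series_weight_shift; try assumption. intros n. apply pow2_ge_0. }
assert (Ext : extremal w F).
{ split; [exact HF|split; [exact NF|]]. rewrite QF. symmetry.
  apply is_lub_Rbar_unique. split.
  - intros r (f & H1 & H2 & ->). simpl. now apply quotient_le.
  - intros B HB. apply HB. exists F. now rewrite QF. }
split; [now exists F|]. now split.
Qed.
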